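(* Let $\mathbb{K}$ be a field of characteristic different from $2$ and let $(A,\mu)$ be a $3$-dimensional nonsolvable skew-symmetric $\mathbb{K}$-algebra. Then $(A,\mu)$ is isomorphic to an algebra with basis $\{e_1,e_2,e_3\}$ and multiplication $$\mu(e_1,e_2)=e_3,\quad \mu(e_1,e_3)=\beta_2e_2+\gamma_2e_3,\quad \mu(e_2,e_3)=\alpha_3e_1+\beta_3e_2+\gamma_3e_3$$ for some $\beta_2,\gamma_2,\alpha_3,\beta_3,\gamma_3\in\mathbb{K}$ with $\alpha_3\beta_2\neq 0$, or to an algebra with basis $\{e_1,e_2,e_3\}$ and multiplication $$\mu(e_1,e_2)=e_3,\quad \mu(e_1,e_3)=\alpha_2e_1+\beta_2e_2+\gamma_2e_3,\quad \mu(e_2,e_3)=\beta_3e_2+\gamma_3e_3$$ for some $\alpha_2,\beta_2,\gamma_2,\beta_3,\gamma_3\in\mathbb{K}$ with $\alpha_2\beta_3\neq 0$.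
   Context: A skew-symmetric $\mathbb{K}$-algebra $(A,\mu)$ is a vector space $A$ with a bilinear map $\mu:A\times A\to A$ satisfying $\mu(X,Y)=-\mu(Y,X)$; no further identity is assumed. Set $\mathcal{D}^0(\mu)=A$, $\mathcal{D}^1(\mu)=\mu(A,A)$ and $\mathcal{D}^k(\mu)=\mu(\mathcal{D}^{k-1}(\mu),\mathcal{D}^{k-1}(\mu))$ for $k\ge 2$ (linear spans of products). $A$ is solvable if $\mathcal{D}^k(\mu)=0$ for some $k$, and nonsolvable otherwise. Algebras $(A,\mu)$, $(A',\mu')$ are isomorphic if there is a linear bijection $f:A\to A'$ with $f(\mu(X,Y))=\mu'(f(X),f(Y))$ for all $X,Y$. *)

(* Defs.v *)
From mathcomp Require Import all_boot all_algebra.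
Set Implicit Arguments.
Unset Strict Implicit.
Unset Printing Implicit Defensive.
Import GRing.Theory.
Local Open Scope ring_scope.

Record skewAlg (K : fieldType) := SkewAlg {
  carrier :> vectType K;
  skmul : {bilinear carrier -> carrier -> carrier};
  skmulC : forall x y : carrier, skmul x y = - skmul y x
}.

Section SkewAlgebra.

Variables (K : fieldType) (A : skewAlg K).
Implicit Types U V W : {vspace A}.

(* The linear span of all products of an element of U and an element of V: by
   bilinearity products of basis vectors suffice; see sub_prodsP. *)
Definition prods U V : {vspace A} :=
  <<[seq skmul A u v | u <- vbasis U, v <- vbasis V]>>%VS.

Lemma mem_prods U V u v : u \in U -> v \in V -> skmul A u v \in prods U V.
Proof.
move=> /coord_vbasis-> /coord_vbasis->.
rewrite linear_sumr rpred_sum // => j _; rewrite linearZr rpredZ //.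
rewrite -applyrE linear_sum rpred_sum // => i _; rewrite linearZ rpredZ //.
by rewrite memv_span //; apply: allpairs_f; rewrite mem_nth ?size_tuple.
Qed.

Lemma sub_prodsP U V W :
  reflect (forall u v, u \in U -> v \in V -> skmul A u v \in W)
          (prods U V <= W)%VS.
Proof.
apply: (iffP idP) => [/subvP sUVW u v Uu Vv | UVW].
  exact/sUVW/mem_prods.
apply/span_subvP => _ /allpairsP[[u v] [/= Uu Vv ->]].
by apply: UVW; exact: vbasis_mem.
Qed.

Fixpoint derived (k : nat) : {vspace A} :=
  if k is k'.+1 then prods (derived k') (derived k') else fullv.

Definition solvable_alg : Prop := exists k : nat, derived k = 0%VS.

End SkewAlgebra.

Definition isomorphic_alg (K : fieldType) (A B : skewAlg K) : Prop :=
  exists2 f : {linear A -> B},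
    bijective f & forall x y : A, f (skmul A x y) = skmul B (f x) (f y).

(* Main.v *)
(** In dimension 3, nonsolvable means perfect: if the derived algebra has
    dimension at most 2, then by skew-symmetry its own derived algebra is
    spanned by a single product, and the next one vanishes. Hence the products
    of the elements of a basis, taken two by two, form a basis again.

    Some basis has the shape (x, y, mu x y). Otherwise every plane is closed
    under mu; testing this on the planes <e_i, e_j> and <e_i, e_j + e_k> gives
      mu e1 e2 = a e1 + b e2, mu e1 e3 = c e1 + b e3, mu e2 e3 = c e2 - a e3,
    and these satisfy c (mu e1 e2) - a (mu e1 e3) - b (mu e2 e3) = 0, which is
    impossible for a basis.

    Finally write mu x (mu x y) = a2 x + b2 y + g2 (mu x y). If b2 = 0, then
    (y, - x) gives the second form; if b2 <> 0, then (x, y + (a2 / b2) x) gives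
    the first one. The nonvanishing of the coefficients is perfection again. *)
Require Import Defs.
From mathcomp Require Import all_boot all_algebra.
From mathcomp Require Import ring.
Set Implicit Arguments.
Unset Strict Implicit.
Unset Printing Implicit Defensive.
Import GRing.Theory.
Local Open Scope ring_scope.

(** * Bases and coordinates in dimension three *)

Section Span3.

Variables (K : fieldType) (V : vectType K).
Implicit Types (x y z v : V) (U : {vspace V}).

Lemma span2P x y v :
  reflect (exists a b, v = a *: x + b *: y) (v \in <<[:: x; y]>>%VS).
Proof.
rewrite span_cons span_seq1; apply: (iffP memv_addP) => [[u /vlineP[a ->]]|].
  by case=> w /vlineP[b ->] ->; exists a, b.
by case=> a [b ->]; exists (a *: x); rewrite ?memvZ ?memv_line //;
  exists (b *: y); rewrite ?memvZ ?memv_line.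
Qed.

Lemma span3P x y z v :
  reflect (exists a b c, v = a *: x + b *: y + c *: z)
          (v \in <<[:: x; y; z]>>%VS).
Proof.
rewrite span_cons; apply: (iffP memv_addP) => [[u /vlineP[a ->]]|].
  by case=> w /span2P[b [c ->]] ->; exists a, b, c; rewrite addrA.
case=> a [b [c ->]]; exists (a *: x); rewrite ?memvZ ?memv_line //.
by exists (b *: y + c *: z); [apply/span2P; exists b, c | rewrite addrA].
Qed.

Lemma mem_span3 x y z (W := <<[:: x; y; z]>>%VS) :
  [/\ x \in W, y \in W & z \in W].
Proof. by split; rewrite memv_span // !inE eqxx ?orbT. Qed.

Hypothesis dimV : \dim {:V} = 3%N.

Lemma basis3E x y z : basis_of fullv [:: x; y; z] = free [:: x; y; z].
Proof. by rewrite basisEfree subvf dimV leqnn !andbT. Qed.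

Lemma basis3_sub x y z U : basis_of fullv [:: x; y; z] ->
  x \in U -> y \in U -> z \in U -> U = fullv.
Proof.
move=> /span_basis defV Ux Uy Uz; apply/eqP; rewrite eqEsubv subvf -defV.
by apply/span_subvP => u; rewrite !inE => /or3P[] /eqP->.
Qed.

(** Three vectors that span a space of dimension 3 are a basis; it is enough to express the old
    basis in the new vectors. *)
Lemma basis3_change x y z x' y' z' : basis_of fullv [:: x; y; z] ->
    x \in <<[:: x'; y'; z']>>%VS -> y \in <<[:: x'; y'; z']>>%VS ->
    z \in <<[:: x'; y'; z']>>%VS ->
  basis_of fullv [:: x'; y'; z'].
Proof.
by move=> bV xS yS zS; rewrite basisEdim dimV (basis3_sub bV xS yS zS) subvv.
Qed.

Lemma basis3_not_sub2 x y z u v (W := <<[:: u; v]>>%VS) :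
  basis_of fullv [:: x; y; z] -> ~ [/\ x \in W, y \in W & z \in W].
Proof.
move=> bV [xW yW zW]; have := dim_span [:: u; v].
by rewrite -/W (basis3_sub bV xW yW zW) dimV.
Qed.

End Span3.

(** Coordinates as linear forms, so that coefficients are compared by applying a form to both sides
    of an equation. *)
Lemma basis3_coord (K : fieldType) (V : vectType K) (x y z : V) :
    basis_of fullv [:: x; y; z] ->
  exists c1 c2 c3 : {scalar V},
    [/\ [/\ c1 x = 1, c1 y = 0 & c1 z = 0], [/\ c2 x = 0, c2 y = 1 & c2 z = 0],
        [/\ c3 x = 0, c3 y = 0 & c3 z = 1]
      & forall v, v = c1 v *: x + c2 v *: y + c3 v *: z].
Proof.
move=> bV; have fX := basis_free bV; pose X := [tuple x; y; z].
exists (coord X 0), (coord X 1), (coord X 2%:R).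
have cE (i j : 'I_3) : coord X j X`_i = (i == j)%:R by apply: coord_free.
split; try by split; [apply: (cE 0) | apply: (cE 1) | apply: (cE 2%:R)].
move=> v; rewrite [LHS](coord_basis (X := X) bV (memvf v)).
rewrite !big_ord_recl big_ord0 /= addr0 addrA.
by congr (_ *: _ + _ *: _ + _ *: _); congr (coord _ _ _); apply: val_inj.
Qed.

(** * Skew products and perfectness *)

Section SkewAlg3.

Variables (K : fieldType) (A : skewAlg K).
Hypothesis charK : 2%N \notin [pchar K].
Implicit Types (x y z v : A) (U : {vspace A}).
Local Notation mu := (skmul A).

(** The characteristic enters here: skew-symmetry gives [2 mu x x = 0]. *)
Lemma skmulxx x : mu x x = 0.
Proof.
apply/eqP; have: 2%:R *: mu x x == 0.
  by rewrite scaler_nat mulr2n {1}skmulC addNr.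
by rewrite scaler_eq0 => /orP[two0|//]; case/negP: charK; rewrite inE /= two0.
Qed.

Lemma prods_span3 x y z U : (U <= <<[:: x; y; z]>>)%VS ->
  (prods U U <= <<[:: mu x y; mu x z; mu y z]>>)%VS.
Proof.
move=> /subvP sU; apply/sub_prodsP => u v /sU/span3P[a [b [c ->]]].
move=> /sU/span3P[a' [b' [c' ->]]].
rewrite !(linearDl, linearDr) /= !linearZl_LR /= !linearZr /= !skmulxx.
rewrite (skmulC y x) (skmulC z x) (skmulC z y).
by rewrite !rpredD ?rpredZ ?rpredN ?mem0v // memv_span // !inE eqxx ?orbT.
Qed.

Hypothesis dimA : \dim {:A} = 3%N.

Lemma nonsolvable3_perfect : ~ solvable_alg A -> prods {:A} {:A} = fullv.
Proof.
move=> nsol; apply/eqP; rewrite eqEdim subvf dimA leqNgt; apply/negP.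
rewrite ltnS => dim2; apply: nsol; exists 3%N => /=.
set U := prods _ _ in dim2 *.
(* Repeating [y] lets [prods_span3] apply to two generators; the default value 0 fills in when [U]
   has dimension below 2. *)
have [x [y sU]] : exists x y, (U <= <<[:: x; y; y]>>)%VS.
  exists (vbasis U)`_0, (vbasis U)`_1.
  rewrite -{1}(span_basis (vbasisP U)); apply/span_subvP => v /(nthP 0)[i].
  rewrite size_tuple => /leq_trans/(_ dim2) lti2 <-.
  by apply: memv_span; case: i lti2 => [|[|]] //= _; rewrite !inE eqxx ?orbT.
have sU1: (prods U U <= <<[:: mu x y; mu x y; mu x y]>>)%VS.
  apply: subv_trans (prods_span3 sU) _; apply/span_subvP => v.
  by rewrite !inE skmulxx => /or3P[] /eqP->;
    rewrite ?mem0v // memv_span // inE eqxx.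
apply/eqP; rewrite -subv0; apply: subv_trans (prods_span3 sU1) _.
by apply/span_subvP => v; rewrite !inE !skmulxx !orbb memv0.
Qed.

(** * Perfect algebras: adapted bases and nonzero coefficients *)

Hypothesis perfA : prods {:A} {:A} = fullv.

Lemma perfect3_basis_mul x y z : basis_of fullv [:: x; y; z] ->
  basis_of fullv [:: mu x y; mu x z; mu y z].
Proof.
move=> /span_basis defA; rewrite basisEdim dimA andbT -{1}perfA.
by apply: prods_span3; rewrite defA.
Qed.

Let adapted := exists x y, basis_of fullv [:: x; y; mu x y].

Lemma adapted_or_sub x y z : basis_of fullv [:: x; y; z] ->
  adapted \/ exists a b, mu x y = a *: x + b *: y.
Proof.
move=> bA; case: (boolP (mu x y \in <<[:: x; y]>>%VS)) => [/span2P|nS].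
  by right.
left; exists x, y; rewrite (basis3E dimA).
have /perm_free-> : perm_eq [:: x; y; mu x y] [:: mu x y; x; y].
  by rewrite (perm_catC [:: x; y] [:: mu x y]).
rewrite free_cons nS /=; apply: (@catr_free _ _ [:: z]).
by have /perm_free <- : perm_eq [:: x; y; z] ([:: z] ++ [:: x; y]);
  [rewrite (perm_catC [:: x; y] [:: z]) | apply: basis_free bA].
Qed.

Lemma adapted_basis_exists x y z : basis_of fullv [:: x; y; z] -> adapted.
Proof.
move=> bA.
(* Permutations and one shear of the basis give all six planes to be tested. *)
have shear u v w : basis_of fullv [:: u; v; w] ->
    basis_of fullv [:: u; v + w; w].
  have [uS vwS wS] := mem_span3 u (v + w) w.
  have := memvB vwS wS; rewrite addrK => vS.
  by move/(basis3_change dimA); apply.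
have rot u v w : basis_of fullv [:: u; v; w] -> basis_of fullv [:: v; w; u].
  by have [? ? ?] := mem_span3 v w u; move/(basis3_change dimA); apply.
have swap u v w : basis_of fullv [:: u; v; w] -> basis_of fullv [:: u; w; v].
  by have [? ? ?] := mem_span3 u w v; move/(basis3_change dimA); apply.
have bA1 := shear _ _ _ bA.
have bA2 := shear _ _ _ (swap _ _ _ (rot _ _ _ bA)).
have bA3 := shear _ _ _ (rot _ _ _ (rot _ _ _ bA)).
have bA4 := swap _ _ _ bA.
have bA5 := rot _ _ _ bA.
have [//|[a [b m12]]] := adapted_or_sub bA.
have [//|[c [d m13]]] := adapted_or_sub bA4.
have [//|[e [f m23]]] := adapted_or_sub bA5.
have [//|[p1 [q1]]] := adapted_or_sub bA1.
have [//|[p2 [q2]]] := adapted_or_sub bA2.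
have [//|[p3 [q3]]] := adapted_or_sub bA3.
rewrite !linearDr /= (skmulC y x) (skmulC z x) (skmulC z y).
rewrite m12 m13 m23 => E3 E2 E1.
have [c1 [c2 [c3 [[c1x c1y c1z] [c2x c2y c2z] [c3x c3y c3z] cK]]]] :=
  basis3_coord bA.
have cE := (c1x, c1y, c1z, c2x, c2y, c2z, c3x, c3y, c3z).
(* In each equation the two summands of the sheared vector have the same coefficient [q1], [q2] or
   [q3]; eliminating it leaves [d = b], [f = - a], [e = c]. *)
have := (congr1 c2 E1, congr1 c3 E1, congr1 c1 E2, congr1 c3 E2,
         congr1 c1 E3, congr1 c2 E3).
rewrite !(linearD, linearN, linearZ) /= !cE.
rewrite !(mulr0, mulr1, addr0, add0r, oppr0, subr0).
move=> [[[[[Eb Ed] Ea] Ef] Ec] Ee].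
have {Eb}Ed' : d = b by rewrite Eb Ed.
have {Ea}Ef' : f = - a by rewrite Ea Ef.
have {Ec}Ee' : e = c by rewrite -[c]opprK Ec -Ee opprK.
have rel : c *: mu x y - a *: mu x z - b *: mu y z = 0.
  rewrite m12 m13 m23 Ed' Ee' Ef' [LHS]cK.
  rewrite !(linearD, linearN, linearZ) /= !cE.
  have combine0 k1 k2 k3 : k1 = 0 -> k2 = 0 -> k3 = 0 ->
      k1 *: x + k2 *: y + k3 *: z = 0.
    by move=> -> -> ->; rewrite !scale0r !addr0.
  by apply: combine0; ring.
(* The products form a basis, so the coefficients of [rel] vanish. *)
have [d1 [d2 [d3 [[d11 d12 d13] [d21 d22 d23] [d31 d32 d33] _]]]] :=
  basis3_coord (perfect3_basis_mul bA).
have dE := (d11, d12, d13, d21, d22, d23, d31, d32, d33).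
have := (congr1 d1 rel, congr1 d2 rel).
have := congr1 d3 rel.
rewrite !(linearB, linearN, linearZ) /= !dE !linear0.
rewrite !(mulr0, mulr1, subr0, sub0r, oppr0).
move=> /eqP; rewrite oppr_eq0 => /eqP b0 [c0] /eqP; rewrite oppr_eq0 => /eqP a0.
(* Now [mu x y = 0], yet [d1] takes the value 1 on it. *)
have := d11; rewrite m12 a0 b0 !scale0r addr0 linear0 => /esym/eqP.
by rewrite oner_eq0.
Qed.

(** The products of the basis vectors cannot all lie in a plane. If [a3 = 0], they lie in that of
    [y] and [mu x y]; if [b2 = 0], then [mu x (mu x y)] is a multiple of [mu x y]. *)
Lemma adapted_form1 x y b2 g2 : basis_of fullv [:: x; y; mu x y] ->
    mu x (mu x y) = b2 *: y + g2 *: mu x y ->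
  exists a3 b3 g3, a3 * b2 != 0 /\
    mu y (mu x y) = a3 *: x + b3 *: y + g3 *: mu x y.
Proof.
move=> bA m13; have bM := perfect3_basis_mul bA.
have not_sub u v := basis3_not_sub2 (u := u) (v := v) dimA bM.
have /span3P[a3 [b3 [g3 m23]]] : mu y (mu x y) \in <<[:: x; y; mu x y]>>%VS.
  by rewrite (span_basis bA) memvf.
exists a3, b3, g3; split=> //; rewrite mulf_eq0; apply/norP; split.
  apply/eqP => a3_0; apply: (not_sub y (mu x y)).
  split; apply/span2P; first by exists 0, 1; rewrite scale0r add0r scale1r.
    by exists b2, g2.
  by exists b3, g3; rewrite m23 a3_0 scale0r add0r.
apply/eqP => b2_0; apply: (not_sub (mu x y) (mu y (mu x y))).
split; apply/span2P; first by exists 1, 0; rewrite scale0r addr0 scale1r.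
  by exists g2, 0; rewrite m13 b2_0 !scale0r addrC.
by exists 0, 1; rewrite scale0r add0r scale1r.
Qed.

(** As before: [a2 = 0] puts the products in the plane of [y] and [mu x y], and [b3 = 0] makes
    [mu y (mu x y)] a multiple of [mu x y]. *)
Lemma adapted_form2 x y b3 g3 : basis_of fullv [:: x; y; mu x y] ->
    mu y (mu x y) = b3 *: y + g3 *: mu x y ->
  exists a2 b2 g2, a2 * b3 != 0 /\
    mu x (mu x y) = a2 *: x + b2 *: y + g2 *: mu x y.
Proof.
move=> bA m23; have bM := perfect3_basis_mul bA.
have not_sub u v := basis3_not_sub2 (u := u) (v := v) dimA bM.
have /span3P[a2 [b2 [g2 m13]]] : mu x (mu x y) \in <<[:: x; y; mu x y]>>%VS.
  by rewrite (span_basis bA) memvf.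
exists a2, b2, g2; split=> //; rewrite mulf_eq0; apply/norP; split.
  apply/eqP => a2_0; apply: (not_sub y (mu x y)).
  split; apply/span2P; first by exists 0, 1; rewrite scale0r add0r scale1r.
    by exists b2, g2; rewrite m13 a2_0 scale0r add0r.
  by exists b3, g3.
apply/eqP => b3_0; apply: (not_sub (mu x y) (mu x (mu x y))).
split; apply/span2P; first by exists 1, 0; rewrite scale0r addr0 scale1r.
  by exists 0, 1; rewrite scale0r add0r scale1r.
by exists g3, 0; rewrite m23 b3_0 !scale0r addrC.
Qed.

End SkewAlg3.

(** * Reduction to the two normal forms *)

Theorem proposition14 (K : fieldType) (A : skewAlg K)
    (charK : 2%N \notin [pchar K])
    (dimA : \dim (fullv : {vspace A}) = 3%N)
    (nsolA : ~ solvable_alg A) :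
  (exists beta2 gamma2 alpha3 beta3 gamma3 : K,
     alpha3 * beta2 != 0 /\
     exists (B : skewAlg K) (e1 e2 e3 : B),
       [/\ basis_of fullv [:: e1; e2; e3],
           skmul B e1 e2 = e3,
           skmul B e1 e3 = beta2 *: e2 + gamma2 *: e3,
           skmul B e2 e3 = alpha3 *: e1 + beta3 *: e2 + gamma3 *: e3
         & isomorphic_alg A B])
  \/
  (exists alpha2 beta2 gamma2 beta3 gamma3 : K,
     alpha2 * beta3 != 0 /\
     exists (B : skewAlg K) (e1 e2 e3 : B),
       [/\ basis_of fullv [:: e1; e2; e3],
           skmul B e1 e2 = e3,
           skmul B e1 e3 = alpha2 *: e1 + beta2 *: e2 + gamma2 *: e3,
           skmul B e2 e3 = beta3 *: e2 + gamma3 *: e3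
         & isomorphic_alg A B]).
Proof.
have perfA := nonsolvable3_perfect charK dimA nsolA.
(* The target algebra is [A] itself; only the basis changes. *)
have isoA : isomorphic_alg A A by exists idfun => //; exists idfun.
have [x0 [y0 [z0 bA0]]] : exists x y z : A, basis_of fullv [:: x; y; z].
  have := vbasisP (fullv : {vspace A}); case: (vbasis _) => s /=.
  by rewrite dimA; case: s => [|x [|y [|z [|]]]] // _ bA; exists x, y, z.
have [x [y bA]] := adapted_basis_exists charK dimA perfA bA0.
have /span3P[a2 [b2 [g2 m13]]] :
    skmul A x (skmul A x y) \in <<[:: x; y; skmul A x y]>>%VS.
  by rewrite (span_basis bA) memvf.
have [b2_0|b2_neq0] := eqVneq b2 0.
  (* The sign of [- x] keeps the third basis vector unchanged. *)
  right; have mN : skmul A y (- x) = skmul A x y by rewrite linearNr -skmulC.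
  have bA' : basis_of fullv [:: y; - x; skmul A y (- x)].
    rewrite mN; have [yS xS mS] := mem_span3 y (- x) (skmul A x y).
    by rewrite memvN in xS; apply: (basis3_change dimA bA).
  have m23 : skmul A (- x) (skmul A y (- x)) =
             a2 *: (- x) + (- g2) *: skmul A y (- x).
    by rewrite mN linearNl /= m13 b2_0 scale0r addr0 opprD scalerN scaleNr.
  have [a [b [g [nz m13']]]] := adapted_form2 charK dimA perfA bA' m23.
  exists a, b, g, a2, (- g2); split=> //.
  by exists A, y, (- x), (skmul A y (- x)).
(* This choice gives [b2 y' = a2 x + b2 y], while [mu x y' = mu x y] because [mu x x = 0]. *)
left; pose y' := y + (a2 / b2) *: x.
have m12 : skmul A x y' = skmul A x y.
  by rewrite linearDr linearZr /= (skmulxx charK) scaler0 addr0.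
have bA' : basis_of fullv [:: x; y'; skmul A x y'].
  rewrite m12; have [xS yS mS] := mem_span3 x y' (skmul A x y).
  apply: (basis3_change dimA bA) => //.
  by have := memvB yS (memvZ (a2 / b2) xS); rewrite addrK.
have m13' : skmul A x (skmul A x y') = b2 *: y' + g2 *: skmul A x y'.
  by rewrite m12 m13 scalerDr scalerA mulrC divfK // [b2 *: y + _]addrC.
have [a [b [g [nz m23]]]] := adapted_form1 charK dimA perfA bA' m13'.
by exists b2, g2, a, b, g; split=> //; exists A, x, y', (skmul A x y').
Qed.
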